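(* Let $M\subset\mathbb{R}$ be an arbitrary subset. Then there is a non-standard model ${}^*\mathbb{Q}^M$ of $\mathbb{Q}$ such that $fp({}^*\mathbb{Q}^M_{fin})\supset M$. Moreover, if $M$ is infinite, then ${}^*\mathbb{Q}^M$ can be chosen to have the same cardinality as $M$.
   Context: A non-standard model of $\mathbb{Q}$ is here an ordered field ${}^*\mathbb{Q}$ (of arbitrary cardinality) which is elementarily equivalent but not isomorphic to $\mathbb{Q}$; elementarily equivalent means that a first-order sentence of arithmetic (in the language of ordered fields) is true in ${}^*\mathbb{Q}$ if and only if it is true in $\mathbb{Q}$. The rationals $\mathbb{Q}$ are canonically embedded in ${}^*\mathbb{Q}$ and identified with their image. Put ${}^*\mathbb{Q}_{fin}:=\{x\in{}^*\mathbb{Q}\mid \exists n\in\mathbb{Q}: -n\le x\le n\}$. Every $x\in{}^*\mathbb{Q}_{fin}$ defines a Dedekind cut $\mathbb{Q}=\{q\in\mathbb{Q}\mid q\le x\}\cup\{q\in\mathbb{Q}\mid q>x\}$, hence a real number $fp(x)=\sup\{q\in\mathbb{Q}\mid q\le x\}$. This defines the order-preserving map $fp\colon{}^*\mathbb{Q}_{fin}\to\mathbb{R}$. *)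

(* Defs.v *)
From mathcomp Require Import all_boot all_order all_algebra.
From mathcomp Require Import all_classical reals.

Set Implicit Arguments.
Unset Strict Implicit.
Unset Printing Implicit Defensive.

Import Order.TTheory GRing.Theory Num.Theory.
Local Open Scope classical_set_scope.
Local Open Scope ring_scope.

(* First-order logic in the language (0, 1, +, -, *, <=) of ordered fields.
   GRing.formula is not suitable: it has no order symbol, and its terms may
   contain arbitrary constants of a fixed ring.

   Syntax is well-scoped: the free variables of a formula over n are indexed
   by 'I_n, and a quantifier binds the variable ord0 of its body (de Bruijn). *)

Inductive of_term (n : nat) : Type :=
| TVar of 'I_n
| TZero
| TOne
| TAdd of of_term n & of_term n
| TOpp of of_term n
| TMul of of_term n & of_term n.

Inductive of_formula (n : nat) : Type :=
| FEq of of_term n & of_term n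
| FLe of of_term n & of_term n
| FFalse
| FAnd of of_formula n & of_formula n
| FOr of of_formula n & of_formula n
| FImp of of_formula n & of_formula n
| FForall of of_formula n.+1
| FExists of of_formula n.+1.

Definition of_sentence : Type := of_formula 0.

Fixpoint eval_term (K : realFieldType) (n : nat) (e : 'I_n -> K)
    (t : of_term n) : K :=
  match t with
  | TVar i => e i
  | TZero => 0
  | TOne => 1
  | TAdd t1 t2 => eval_term e t1 + eval_term e t2
  | TOpp t1 => - eval_term e t1
  | TMul t1 t2 => eval_term e t1 * eval_term e t2
  end.

Definition env_cons (T : Type) (n : nat) (x : T) (e : 'I_n -> T)
    (i : 'I_n.+1) : T :=
  if unlift ord0 i is Some j then e j else x.

Fixpoint holds (K : realFieldType) (n : nat) (e : 'I_n -> K)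
    (f : of_formula n) : Prop :=
  match f in of_formula _ return Prop with
  | FEq t1 t2 => eval_term e t1 = eval_term e t2
  | FLe t1 t2 => eval_term e t1 <= eval_term e t2
  | FFalse => False
  | FAnd f1 f2 => holds e f1 /\ holds e f2
  | FOr f1 f2 => holds e f1 \/ holds e f2
  | FImp f1 f2 => holds e f1 -> holds e f2
  | FForall f1 => forall x : K, holds (env_cons x e) f1
  | FExists f1 => exists x : K, holds (env_cons x e) f1
  end.

Definition sentence_true (K : realFieldType) (f : of_sentence) : Prop :=
  holds (fun i : 'I_0 => match notF (ltn_ord i) return K with end) f.

Definition elementarily_equivalent (K L : realFieldType) : Prop :=
  forall f : of_sentence, sentence_true K f <-> sentence_true L f.

Definition ordered_field_isomorphic (K L : realFieldType) : Prop :=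
  exists f : {rmorphism K -> L}, bijective f /\ {mono f : x y / x <= y}.

Definition nonstandard_model (K : realFieldType) : Prop :=
  elementarily_equivalent K rat /\ ~ ordered_field_isomorphic K rat.

Definition fin_part (K : realFieldType) : set K :=
  [set x | exists n : rat, - ratr n <= x <= ratr n].
Arguments fin_part : clear implicits.

(* Meaningful only on fin_part K: elsewhere the set may be empty or unbounded,
   and sup then takes a default value. *)
Definition fp (R : realType) (K : realFieldType) (x : K) : R :=
  sup [set ratr q | q in [set q : rat | ratr q <= x]].
Arguments fp : clear implicits.

(* Main.v *)
From HB Require Import structures.
Require Import Defs.
From mathcomp Require Import all_boot all_order all_algebra.
From mathcomp Require Import all_classical reals.

Local Open Scope classical_set_scope.
Local Open Scope card_scope.
Local Open Scope ring_scope.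

(** The models are reduced powers of the rationals that use only a chosen
    family of sequences.  Fix a non-principal ultrafilter [U] on the natural
    numbers.  In the full ultrapower every real number [m] is a finite part:
    a sequence of rationals tending to [m] represents an element infinitely
    close to [m].  The full ultrapower has the cardinality of the continuum,
    so for a small set [M] one must cut it down.  Instead of forming the
    ultrapower and taking an elementary substructure, both steps are done at
    once.  Start from one sequence of rationals converging to each [m] in [M],
    together with the sequence [0, 1, 2, ...], and close this set under
    Skolem functions of the rationals, one for each first-order formula,
    applied pointwise ([hull]).  The quotient of this family modulo [U] is an
    ordered field.

    The theorem of Los ([los]) holds for this quotient: for an existential
    formula its proof needs a sequence of pointwise witnesses, and the closure
    property [sk_closed] provides one inside the family.  Hence
    the quotient is elementarily equivalent to the rationals.  It is not
    isomorphic to them because the class of [0, 1, 2, ...] exceeds every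
    integer ([ultrafield_nonstandard]), and the class of the sequence chosen
    for [m] has finite part [m] ([fp_ultrafield]).

    As there are countably many formulas, the elements of the family are named
    by finite trees, whose inner nodes carry codes of formulas and whose leaves
    carry elements of [option M].  For infinite [M] there are only as many
    trees as elements of [M].  This rests on the theorem of Hessenberg that an
    infinite set is equinumerous with its square ([card_square_infinite]).
    Conversely the finite part maps a subset of the model onto [M], so the two
    cardinalities agree. *)

Set Implicit Arguments.
Unset Strict Implicit.
Unset Printing Implicit Defensive.

Import Order.TTheory GRing.Theory Num.Theory.
Local Open Scope quotient_scope.

(** * Cardinal arithmetic of infinite sets *)

Lemma card_le_rel (T U : Type) (A : set T) (B : set U) (G : T -> U -> Prop) :
  (forall x, A x -> exists2 y, B y & G x y) ->
  (forall x x' y, G x y -> G x' y -> x = x') -> A #<= B.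
Proof.
move=> Gtot Ginj.
have /choice[f fP] (x : A) : exists y : B, G (val x) (val y).
  have [y By Gxy] := Gtot _ (set_valP x).
  by exists (SigSub (mem_set By)).
apply/card_leP; apply/injfunPex; exists f => // x x' _ _ fxx'.
by apply/val_inj/(Ginj _ _ (val (f x))); [exact: fP | rewrite fxx'; exact: fP].
Qed.

Lemma inj_card_leT (T U : Type) (f : T -> U) :
  injective f -> [set: T] #<= [set: U].
Proof.
move=> fI; apply: (@card_le_rel _ _ _ _ (fun x y => f x = y)).
  by move=> x _; exists (f x).
by move=> x x' y <- /fI.
Qed.

(** Conditions on a graph that involve two of its points at a time pass to the
    union of a chain by this remark. *)
Lemma chain_pair (T : Type) (F : set (set T)) a b :
  total_on F subset -> (\bigcup_(X in F) X) a -> (\bigcup_(X in F) X) b ->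
  exists X, [/\ F X, X a & X b].
Proof.
move=> Ftot [X FX Xa] [Y FY Yb].
have [XY|YX] := Ftot X Y FX FY; first by exists Y; split=> //; exact: XY.
by exists X; split=> //; exact: YX.
Qed.

(** A maximal graph of a partial injection exhausts one of the two sets, since
    otherwise one more pair could be added to it. *)
Lemma card_le_total (T U : Type) (A : set T) (B : set U) :
  A #<= B \/ B #<= A.
Proof.
pose P : set (set (T * U)) := [set G |
  G `<=` A `*` B /\ forall p q, G p -> G q -> p.1 = q.1 <-> p.2 = q.2].
have [|G [[GAB GI] Gmax]] := @Zorn_bigcup _ P.
  move=> F FP Ftot; split; first by move=> p [X /FP[XAB _]] /XAB.
  move=> p q Hp Hq; have [X [/FP[_ XI] Xp Xq]] := chain_pair Ftot Hp Hq.
  exact: XI.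
have [GA|] := pselect (forall x, A x -> exists y, G (x, y)).
  left; apply: (@card_le_rel _ _ _ _ (fun x y => G (x, y))).
    by move=> x /GA[y Gxy]; exists y => //; have [] := GAB _ Gxy.
  by move=> x x' y Gxy Gx'y; apply/(GI _ _ Gxy Gx'y).
move=> /existsNP[x /not_implyP[Ax /forallNP nGx]].
have [GB|] := pselect (forall y, B y -> exists x, G (x, y)).
  right; apply: (@card_le_rel _ _ _ _ (fun y x => G (x, y))).
    by move=> y /GB[z Gzy]; exists z => //; have [] := GAB _ Gzy.
  by move=> y y' z Gzy Gzy'; apply/(GI _ _ Gzy Gzy').
move=> /existsNP[y /not_implyP[By /forallNP nGy]].
have /Gmax[] : G `<` G `|` [set (x, y)].
  by split=> [p Gp|/(_ (x, y) (or_intror erefl)) /nGx//]; left.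
split; first by move=> p [/GAB//|->].
move=> [a b] [c d] [Gp|[-> ->]] [Gq|[-> ->]] //=; first exact: (GI _ _ Gp Gq).
- by split=> e; subst; [case: (nGx _ Gp) | case: (nGy _ Gp)].
- by split=> e; subst; [case: (nGx _ Gq) | case: (nGy _ Gq)].
Qed.

(** Injections from [A * A] to [A] are represented by their graphs because the
    set [A] has to vary: graphs are ordered by inclusion. *)
Definition square_graph (T : Type) (A : set T) (G : set ((T * T) * T)) :=
  [/\ forall p, (exists z, G (p, z)) <-> A p.1 /\ A p.2,
      forall p z, G (p, z) -> A z
    & forall p q, G p -> G q -> p.1 = q.1 <-> p.2 = q.2].

(** The diagonal of the domain determines the set [A], which provides the side
    of a union of graphs. *)
Definition graph_side (T : Type) (G : set ((T * T) * T)) : set T :=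
  [set x | exists z, G ((x, x), z)].

Lemma square_graph_chain (T : Type) (F : set (set ((T * T) * T))) :
  total_on F subset -> (forall G, F G -> exists A, square_graph A G) ->
  exists A, square_graph A (\bigcup_(G in F) G).
Proof.
move=> Ftot Fsq; exists (graph_side (\bigcup_(G in F) G)); split.
- move=> [x y]; split=> [[z [G FG Gxyz]]|[/= [z Gx] [t Gy]]].
    have [A sqG] := Fsq _ FG; have [GA _ _] := sqG.
    have [/= Ax Ay] : A x /\ A y by apply/(GA (x, y)); exists z.
    by split; [have [|z' ?] := (GA (x, x)).2 | have [|z' ?] := (GA (y, y)).2];
      rewrite //; exists z', G.
  have [G [FG Gxx Gyy]] := chain_pair Ftot Gx Gy.
  have [A sqG] := Fsq _ FG; have [GA _ _] := sqG.
  have [|z' Gxy] := (GA (x, y)).2; last by exists z', G.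
  by split; [apply: (proj1 ((GA (x, x)).1 _)); exists z
            | apply: (proj1 ((GA (y, y)).1 _)); exists t].
- move=> p z [G FG Gpz]; have [A [GA Gim _]] := Fsq _ FG.
  have [|z' ?] := (GA (z, z)).2; first by have := Gim _ _ Gpz.
  by exists z', G.
- move=> p q Hp Hq; have [G [FG Gp Gq]] := chain_pair Ftot Hp Hq.
  by have [A [_ _ GI]] := Fsq _ FG; exact: GI.
Qed.


Lemma square_graph_fun (T : Type) (A : set T) G :
  square_graph A G -> exists f : T -> T -> T,
    (forall x y, A x -> A y -> A (f x y) /\ G ((x, y), f x y)) /\
    (forall x y x' y', A x -> A y -> A x' -> A y' ->
       f x y = f x' y' -> x = x' /\ y = y').
Proof.
move=> [GA Gim GI].
have /choice[f fP] (p : T * T) : exists z, A p.1 -> A p.2 -> A z /\ G (p, z).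
  have [[A1 A2]|nA] := pselect (A p.1 /\ A p.2); last first.
    by exists p.1 => A1 A2; case: nA.
  by have [|z Gpz] := (GA p).2 => //; exists z; split=> //; exact: Gim Gpz.
exists (fun x y => f (x, y)); split=> [x y Ax Ay|x y x' y' Ax Ay Ax' Ay' ff'].
  exact: (fP (x, y)).
have [_ Gxy] := fP (x, y) Ax Ay; have [_ Gxy'] := fP (x', y') Ax' Ay'.
by case: ((GI _ _ Gxy Gxy').2 ff').
Qed.

Lemma square_graph_nat (T : Type) (c : nat -> T) :
  injective c -> exists G, square_graph (range c) G.
Proof.
move=> cI.
exists [set ((c m.1, c m.2), c (pickle m)) | m in [set: nat * nat]]; split.
- move=> [x y]; split=> [[z [m _ [<- <- _]]]|[/= [m _ <-] [n _ <-]]].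
    by split; [exists m.1 | exists m.2].
  by exists (c (pickle (m, n))), (m, n).
- by move=> _ _ [m _ [_ <-]]; exists (pickle m).
- move=> _ _ [[m n] _ <-] [[m' n'] _ <-] /=; split=> [[/cI -> /cI ->]//|].
  by move=> /cI /(pcan_inj pickleK)[-> ->].
Qed.

(** Both [A] and a set [D] not larger than [A] embed into [A * A], as subsets of
    the disjoint rows [a0] and [a1], hence [A `|` D] embeds into [A]. *)
Lemma square_graph_absorb (T : Type) (A D : set T) G (k : T -> T) (a0 a1 : T) :
  square_graph A G -> A a0 -> A a1 -> a0 <> a1 ->
  (forall x, D x -> A (k x)) -> {in D &, injective k} ->
  exists g : T -> T, (forall x, (A `|` D) x -> A (g x)) /\
    (forall x y, (A `|` D) x -> (A `|` D) y -> g x = g y -> x = y).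
Proof.
move=> /square_graph_fun[f [fA fI]] Aa0 Aa1 a01 kA kI.
exists (fun x => if `[< A x >] then f a0 x else f a1 (k x)); split=> [x|x y].
  by case: asboolP => [Ax _|nAx [//|Dx]];
    apply: (fA _ _ _ _).1 => //; exact: kA.
case: asboolP => [Ax _|nAx [//|Dx]]; case: asboolP => [Ay _|nAy [//|Dy]].
- by case/fI.
- by case/fI => //; exact: kA.
- by case/fI => //; [exact: kA|move=> /esym].
- case/fI => //; [exact: kA|exact: kA|move=> _].
  by apply: kI; rewrite inE.
Qed.

(** If [A] has a disjoint copy [j @` A], the square of the union [C] of the two
    exceeds [A * A] by pairs that can all be sent injectively into the copy:
    [C] embeds into [A] by some [g], hence [C * C] into [A] by [f], and [j]
    carries the result to the copy, away from the values used before. *)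
Lemma square_graph_grow (T : Type) (A : set T) G (j : T -> T) (a0 a1 : T) :
  square_graph A G -> A a0 -> A a1 -> a0 <> a1 ->
  (forall x, A x -> ~ A (j x)) -> {in A &, injective j} ->
  exists2 G', square_graph (A `|` j @` A) G' & G `<` G'.
Proof.
move=> sqG Aa0 Aa1 a01 jA jI.
have /choice[k kP] (y : T) : exists x, (j @` A) y -> A x /\ j x = y.
  have [[x Ax <-]|n] := pselect ((j @` A) y); first by exists x.
  by exists y => /n.
have [||g [gA gI]] :=
    square_graph_absorb (D := j @` A) (k := k) sqG Aa0 Aa1 a01.
- by move=> y /kP[].
- move=> y y'; rewrite !inE => /kP[_ ky] /kP[_ ky'] kk'.
  by rewrite -ky -ky' kk'.
have [f [fA fI]] := square_graph_fun sqG.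
have [GA Gim GI] := sqG.
set C := A `|` j @` A in gA gI *.
pose G' := G `|` [set ((p.1, p.2), j (f (g p.1) (g p.2))) |
                    p in [set p | [/\ C p.1, C p.2 & ~ (A p.1 /\ A p.2)]]].
exists G'; last first.
  split=> [p Gp|]; first by left.
  have Cja0 : C (j a0) by right; exists a0.
  move=> /(_ ((j a0, j a0), j (f (g (j a0)) (g (j a0))))) GG.
  have /GG G0 : G' (j a0, j a0, j (f (g (j a0)) (g (j a0)))).
    right; exists (j a0, j a0) => //; split=> //= -[Aj _].
    exact: jA _ Aa0 Aj.
  have [Aj _] : A (j a0) /\ A (j a0).
    by apply/(GA (j a0, j a0)); eexists; exact: G0.
  exact: jA _ Aa0 Aj.
have fgA x y : C x -> C y -> A (f (g x) (g y)).
  by move=> Cx Cy; apply: (fA _ _ _ _).1; exact: gA.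
split.
- move=> [x y].
  split=> /= [[z [Gxyz|[[x' y'] [/= Cx Cy _] [<- <- _]]]]|[Cx Cy]] //.
    by have [] : A x /\ A y by [apply/(GA (x, y)); exists z]; split; left.
  have [/(GA (x, y))[z Gz]|nA] := pselect (A x /\ A y); first by exists z; left.
  by exists (j (f (g x) (g y))); right; exists (x, y).
- move=> p z [/Gim Az|[[x y] [/= Cx Cy _] [_ <-]]]; first by left.
  by right; exists (f (g x) (g y)) => //; exact: fgA.
- move=> [p z] [q t] [Gpz|[[x y] [/= Cx Cy nA] [<- <-]]]
             [Gqt|[[x' y'] [/= Cx' Cy' nA'] [<- <-]]] /=.
  + exact: (GI _ _ Gpz Gqt).
  + split=> [pq|zj]; last first.
      by case: (jA _ (fgA _ _ Cx' Cy')); rewrite -zj; exact: Gim Gpz.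
    by case: nA'; apply/(GA (x', y')); exists z; rewrite -pq.
  + split=> [pq|zj]; last first.
      by case: (jA _ (fgA _ _ Cx Cy)); rewrite zj; exact: Gim Gqt.
    by case: nA; apply/(GA (x, y)); exists t; rewrite pq.
  + split=> [[-> ->]//|].
    move=> /(jI _ _ (mem_set (fgA _ _ Cx Cy)) (mem_set (fgA _ _ Cx' Cy'))).
    by case/fI; try exact: gA; move=> /gI -> // /gI ->.
Qed.

(** Theorem of Hessenberg.  For a maximal graph, with side [A], the complement
    of [A] cannot contain a copy of [A], as the graph could then be extended.
    By comparability the complement embeds into [A], so the whole type embeds
    into [A] as well, and its square into [A * A] and thus into [A]. *)
Lemma card_square_infinite (T : Type) :
  infinite_set [set: T] -> [set: T * T] #<= [set: T].
Proof.
elim/Ppointed: T => T; first by rewrite emptyE.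
move=> /infiniteP /pcard_injP[c /in2TT cI].
have [G0 sq0] := square_graph_nat cI.
(* Taking the union with [G0] keeps [A] infinite and covers the empty chain. *)
pose P : set (set ((T * T) * T)) :=
  [set G | exists A, square_graph A (G0 `|` G)].
have [F FP Ftot|G [[A sqA] Gmax]] := @Zorn_bigcup _ P.
  have [->|/set0P[X FX]] := eqVneq F set0.
    by exists (range c); rewrite bigcup_set0 setU0.
  rewrite /P/=.
  have -> : G0 `|` \bigcup_(X in F) X =
            \bigcup_(Y in [set G0 `|` X | X in F]) Y.
    apply/seteqP; split=> p.
      move=> [G0p|[Y FY Yp]]; first by exists (G0 `|` X); [exists X|left].
      by exists (G0 `|` Y); [exists Y|right].
    by move=> [_ [Y FY <-] [|Yp]]; [left|right; exists Y].
  apply: square_graph_chain => [_ _ [Y FY <-] [Z FZ <-]|_ [Y /FP[B] ? <-]].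
    by have [YZ|ZY] := Ftot Y Z FY FZ; [left|right]; apply: setUS.
  by exists B.
have cA n : A (c n).
  have [GA _ _] := sq0; have [HA _ _] := sqA.
  have [|z G0z] := (GA (c n, c n)).2; first by split; exists n.
  by apply: ((HA (c n, c n)).1 _).1; exists z; left.
have c01 : c 0 <> c 1 by move=> /cI.
have [le_ACA|] := card_le_total A (~` A); last first.
  move=> /ppcard_leP[k].
  have [||g [gA gI]] :=
    square_graph_absorb (D := ~` A) (k := k) sqA (cA 0) (cA 1) c01.
  - by move=> x nAx; exact: funS.
  - exact: inj.
  have [f [fA fI]] := square_graph_fun sqA.
  rewrite setUv in gA gI.
  apply: (inj_card_leT (f := fun p => f (g p.1) (g p.2))).
  move=> -[x y] [x' y'] /= e.
  have [gx gy] := fI _ _ _ _ (gA x I) (gA y I) (gA x' I) (gA y' I) e.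
  by rewrite (gI x x' I I gx) (gI y y' I I gy).
move: le_ACA => /ppcard_leP[j].
have [||G' sqG' [GG' nG'G]] := square_graph_grow (j := j) sqA (cA 0) (cA 1) c01.
- by move=> x Ax; have := @funS _ _ _ _ j x Ax.
- exact: inj.
have /Gmax[] : G `<` G'.
  by split=> [p Gp|G'G]; [apply: GG'; right | apply: nG'G => p /G'G; right].
exists (A `|` j @` A).
suff -> : G0 `|` G' = G' by [].
by apply/setUidPr => p G0p; apply: GG'; left.
Qed.

Lemma card_seq_infinite (T : Type) :
  infinite_set [set: T] -> [set: seq (nat + T)] #<= [set: T].
Proof.
elim/Ppointed: T => T; first by rewrite emptyE.
move=> Tinf; have /infiniteP/pcard_injP[c /in2TT cI] := Tinf.
have /pcard_injP[p /in2TT pI] := card_square_infinite Tinf.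
(* The first component tells apart the end of the sequence, the entries from the
   right summand and those from the left one. *)
pose enc := foldr (fun (x : nat + T) s =>
  match x with inl n => p (c n.+2, s) | inr x => p (c 1, p (x, s)) end)
  (p (c 0, c 0)).
apply: (inj_card_leT (f := enc)); elim=> [|[n|x] s IHs] [|[m|y] t] //=.
- by move=> /pI[/cI].
- by move=> /pI[/cI].
- by move=> /pI[/cI].
- by move=> /pI[/cI[->] /IHs ->].
- by move=> /pI[/cI].
- by move=> /pI[/cI].
- by move=> /pI[/cI].
- by move=> /pI[/pI[-> /IHs ->]].
Qed.

Lemma card_option_infinite (T : Type) :
  infinite_set [set: T] -> [set: option T] #<= [set: T].
Proof.
move=> Tinf; apply: card_le_trans (card_square_infinite Tinf).
move: Tinf; elim/Ppointed: T => T; first by rewrite emptyE.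
move=> /infiniteP/pcard_injP[c /in2TT cI].
apply: (inj_card_leT (f := fun o : option T =>
  if o is Some x then (c 1, x) else (c 0, c 0))) => -[x|] [y|] //=.
- by move=> [->].
- by move=> [/cI].
- by move=> [/cI].
Qed.

(** * The quotient of a family closed under Skolem functions *)

Lemma env_cons0 (T : Type) (n : nat) (x : T) (e : 'I_n -> T) :
  env_cons x e ord0 = x.
Proof. by rewrite /env_cons unlift_none. Qed.

Lemma env_consS (T : Type) (n : nat) (x : T) (e : 'I_n -> T) (j : 'I_n) :
  env_cons x e (lift ord0 j) = e j.
Proof. by rewrite /env_cons liftK. Qed.

Lemma env_cons_comp (T U : Type) (n : nat) (f : T -> U) (x : T)
    (e : 'I_n -> T) :
  (fun j => f (env_cons x e j)) = env_cons (f x) (fun j => f (e j)).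
Proof. by apply/funext => j; rewrite /env_cons; case: unlift. Qed.

Lemma near_or (I : Type) (U : set_system I) (P Q : set I) :
  UltraFilter U -> (\forall i \near U, P i \/ Q i) ->
  (\forall i \near U, P i) \/ (\forall i \near U, Q i).
Proof.
move=> UU UPQ; have [UP|UnP] := in_ultra_setVsetC P UU; first by left.
by right; apply: filterS2 UPQ UnP => i [].
Qed.

Lemma near_not (I : Type) (U : set_system I) (P : set I) :
  UltraFilter U -> ~ (\forall i \near U, P i) -> \forall i \near U, ~ P i.
Proof. by move=> UU nUP; have [//|] := in_ultra_setVsetC P UU. Qed.

(** A set of functions [I -> L] closed under the choice of witnesses of
    first-order formulas, with an ultrafilter on [I].  For all functions this
    gives the ultrapower of [L]; smaller families give elementary substructures
    of it.  The proofs are bundled with the data so that the field structure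
    can be inferred from the type of the quotient alone. *)
Record skolem_family (I : Type) (L : realFieldType) := SkolemFamily {
  sk_index : choiceType;
  sk_val : sk_index -> I -> L;
  sk_filter : set_system I;
  sk_ultra : UltraFilter sk_filter;
  sk_closed : forall (n : nat) (f : of_formula n.+1) (e : 'I_n -> sk_index),
    exists s, forall i,
      (exists x, holds (env_cons x (fun j => sk_val (e j) i)) f) ->
      holds (env_cons (sk_val s i) (fun j => sk_val (e j) i)) f }.

#[global] Existing Instance sk_ultra.

Section UltraQuotient.
Variables (I : Type) (L : realFieldType) (F : skolem_family I L).
Local Notation S := (sk_index F).
Local Notation val := (@sk_val I L F).
Local Notation U := (sk_filter F).

Definition sk_eqv (s t : S) : bool :=
  `[< \forall i \near U, val s i = val t i >].

Lemma sk_eqv_equiv : equiv_class_of sk_eqv.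
Proof.
split=> [s|s t|s t u]; first by apply/asboolP/nearW.
  by apply/asboolP/asboolP; apply: filterS.
move=> /asboolP st /asboolP tu; apply/asboolP.
by apply: filterS2 st tu => i -> ->.
Qed.

Canonical sk_eqv_rel := EquivRelPack sk_eqv_equiv.

Definition uquot := {eq_quot sk_eqv_rel}.
HB.instance Definition _ := Choice.on uquot.
HB.instance Definition _ := EqQuotient.on uquot.

Local Notation pi := (\pi_uquot).
Definition uval (x : uquot) (i : I) : L := val (repr x) i.

Lemma uquotP (s t : S) : pi s = pi t <-> \forall i \near U, val s i = val t i.
Proof.
split=> [/eqP|st]; first by rewrite eqmodE => /asboolP.
by apply/eqP; rewrite eqmodE; apply/asboolP.
Qed.

(** The representative chosen in the class of [s] may differ from [s], but only
    outside of a set of the ultrafilter. *)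
Lemma uval_pi (s : S) : \forall i \near U, uval (pi s) i = val s i.
Proof. by apply/uquotP; rewrite reprK. Qed.

Lemma uvalP (x y : uquot) : x = y <-> \forall i \near U, uval x i = uval y i.
Proof. by rewrite -{1}[x]reprK -{1}[y]reprK uquotP. Qed.

(** Closure under Skolem functions contains closure under every operation with a
    first-order definable graph; the field operations are instances. *)
Lemma sk_fun (n : nat) (op : ('I_n -> L) -> L) (f : of_formula n.+1) :
  (forall z e, holds (env_cons z e) f <-> z = op e) ->
  forall e : 'I_n -> S, exists s, forall i,
    val s i = op (fun j => val (e j) i).
Proof.
move=> fop e; have [s sP] := sk_closed f e.
by exists s => i; apply/fop/sP; eexists; apply/fop.
Qed.

Let env0 : 'I_0 -> S := fun j => match notF (ltn_ord j) with end.
(* In the formulas below [v0] is the result and [v1], [v2] the arguments. *)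
Let v0 {n} : of_term n.+1 := TVar ord0.
Let v1 {n} : of_term n.+2 := TVar (lift ord0 ord0).
Let v2 {n} : of_term n.+3 := TVar (lift ord0 (lift ord0 ord0)).

Lemma sk_zero_subproof : exists s, forall i, val s i = 0.
Proof.
apply: (@sk_fun 0 (fun=> 0) (FEq v0 (TZero _)) _ env0) => z e /=.
by rewrite env_cons0.
Qed.

Lemma sk_one_subproof : exists s, forall i, val s i = 1.
Proof.
apply: (@sk_fun 0 (fun=> 1) (FEq v0 (TOne _)) _ env0) => z e /=.
by rewrite env_cons0.
Qed.

Lemma sk_opp_subproof s : exists t, forall i, val t i = - val s i.
Proof.
apply: (@sk_fun 1 (fun e => - e ord0) (FEq v0 (TOpp v1)) _ (fun=> s)) => z e /=.
by rewrite env_cons0 env_consS.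
Qed.

(** The formula has a second case because the inverse of zero is zero. *)
Lemma sk_inv_subproof s : exists t, forall i, val t i = (val s i)^-1.
Proof.
apply: (@sk_fun 1 (fun e => (e ord0)^-1)
  (FOr (FEq (TMul v0 v1) (TOne _))
       (FAnd (FEq v1 (TZero _)) (FEq v0 (TZero _)))) _ (fun=> s)) => z e /=.
rewrite env_cons0 env_consS; split=> [[/mulr1_eq <-|[-> ->]]|->].
- by rewrite invrK.
- by rewrite invr0.
- have [->|e0] := eqVneq (e ord0) 0; first by right; rewrite invr0.
  by left; rewrite mulVf.
Qed.

Lemma sk_add_subproof s t : exists u, forall i, val u i = val s i + val t i.
Proof.
have [|u uP] := @sk_fun 2 (fun e => e ord0 + e (lift ord0 ord0))
  (FEq v0 (TAdd v1 v2)) _ (env_cons s (fun=> t)).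
  by move=> z e /=; rewrite env_cons0 !env_consS.
by exists u => i; rewrite uP env_cons0 env_consS.
Qed.

Lemma sk_mul_subproof s t : exists u, forall i, val u i = val s i * val t i.
Proof.
have [|u uP] := @sk_fun 2 (fun e => e ord0 * e (lift ord0 ord0))
  (FEq v0 (TMul v1 v2)) _ (env_cons s (fun=> t)).
  by move=> z e /=; rewrite env_cons0 !env_consS.
by exists u => i; rewrite uP env_cons0 env_consS.
Qed.

Definition sk_zero : S := sval (cid sk_zero_subproof).
Definition sk_one : S := sval (cid sk_one_subproof).
Definition sk_opp s : S := sval (cid (sk_opp_subproof s)).
Definition sk_inv s : S := sval (cid (sk_inv_subproof s)).
Definition sk_add s t : S := sval (cid (sk_add_subproof s t)).
Definition sk_mul s t : S := sval (cid (sk_mul_subproof s t)).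

Lemma sk_zeroE i : val sk_zero i = 0.
Proof. exact: (svalP (cid sk_zero_subproof)). Qed.
Lemma sk_oneE i : val sk_one i = 1.
Proof. exact: (svalP (cid sk_one_subproof)). Qed.
Lemma sk_oppE s i : val (sk_opp s) i = - val s i.
Proof. exact: (svalP (cid (sk_opp_subproof s))). Qed.
Lemma sk_invE s i : val (sk_inv s) i = (val s i)^-1.
Proof. exact: (svalP (cid (sk_inv_subproof s))). Qed.
Lemma sk_addE s t i : val (sk_add s t) i = val s i + val t i.
Proof. exact: (svalP (cid (sk_add_subproof s t))). Qed.
Lemma sk_mulE s t i : val (sk_mul s t) i = val s i * val t i.
Proof. exact: (svalP (cid (sk_mul_subproof s t))). Qed.
Definition skE := (sk_zeroE, sk_oneE, sk_oppE, sk_invE, sk_addE, sk_mulE).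

Definition uzero : uquot := pi sk_zero.
Definition uone : uquot := pi sk_one.
Definition uopp (x : uquot) : uquot := pi (sk_opp (repr x)).
Definition uinv (x : uquot) : uquot := pi (sk_inv (repr x)).
Definition uadd (x y : uquot) : uquot := pi (sk_add (repr x) (repr y)).
Definition umul (x y : uquot) : uquot := pi (sk_mul (repr x) (repr y)).
Definition ule (x y : uquot) : bool :=
  `[< \forall i \near U, uval x i <= uval y i >].

Lemma pi_opp s : uopp (pi s) = pi (sk_opp s).
Proof.
by apply/uquotP; apply: filterS (uval_pi s) => i; rewrite !skE => <-.
Qed.
Lemma pi_inv s : uinv (pi s) = pi (sk_inv s).
Proof.
by apply/uquotP; apply: filterS (uval_pi s) => i; rewrite !skE => <-.
Qed.
Lemma pi_add s t : uadd (pi s) (pi t) = pi (sk_add s t).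
Proof.
apply/uquotP; apply: filterS2 (uval_pi s) (uval_pi t) => i.
by rewrite !skE => <- <-.
Qed.
Lemma pi_mul s t : umul (pi s) (pi t) = pi (sk_mul s t).
Proof.
apply/uquotP; apply: filterS2 (uval_pi s) (uval_pi t) => i.
by rewrite !skE => <- <-.
Qed.
Definition upiE := (pi_opp, pi_inv, pi_add, pi_mul).

Lemma pi_surj (P : uquot -> Prop) : (forall s, P (pi s)) -> forall x, P x.
Proof. by move=> Ppi x; rewrite -[x]reprK. Qed.

Lemma uaddA : associative uadd.
Proof.
elim/pi_surj=> x; elim/pi_surj=> y; elim/pi_surj=> z; rewrite !upiE.
by apply/uquotP/nearW => i; rewrite !skE addrA.
Qed.

Lemma uaddC : commutative uadd.
Proof.
elim/pi_surj=> x; elim/pi_surj=> y; rewrite !upiE.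
by apply/uquotP/nearW => i; rewrite !skE addrC.
Qed.

Lemma uadd0 : left_id uzero uadd.
Proof.
elim/pi_surj=> x; rewrite upiE.
by apply/uquotP/nearW => i; rewrite !skE add0r.
Qed.

Lemma uaddN : left_inverse uzero uopp uadd.
Proof.
elim/pi_surj=> x; rewrite !upiE.
by apply/uquotP/nearW => i; rewrite !skE addNr.
Qed.

HB.instance Definition _ := GRing.isZmodule.Build uquot uaddA uaddC uadd0 uaddN.

Lemma umulA : associative umul.
Proof.
elim/pi_surj=> x; elim/pi_surj=> y; elim/pi_surj=> z; rewrite !upiE.
by apply/uquotP/nearW => i; rewrite !skE mulrA.
Qed.

Lemma umulC : commutative umul.
Proof.
elim/pi_surj=> x; elim/pi_surj=> y; rewrite !upiE.
by apply/uquotP/nearW => i; rewrite !skE mulrC.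
Qed.

Lemma umul1 : left_id uone umul.
Proof.
elim/pi_surj=> x; rewrite upiE.
by apply/uquotP/nearW => i; rewrite !skE mul1r.
Qed.

Lemma umulD : left_distributive umul uadd.
Proof.
elim/pi_surj=> x; elim/pi_surj=> y; elim/pi_surj=> z; rewrite !upiE.
by apply/uquotP/nearW => i; rewrite !skE mulrDl.
Qed.

Lemma uone_neq0 : uone != uzero.
Proof.
apply/eqP => /uquotP U10; suff : U set0 by exact: filter_not_empty.
by apply: filterS U10 => i; rewrite !skE => /eqP; rewrite oner_eq0.
Qed.

HB.instance Definition _ :=
  GRing.Zmodule_isComNzRing.Build uquot umulA umulC umul1 umulD uone_neq0.

Lemma umulV (x : uquot) : x != 0 -> umul (uinv x) x = 1.
Proof.
elim/pi_surj: x => s /eqP /uquotP /near_not nz; rewrite !upiE.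
apply/uquotP; apply: filterS nz => i; rewrite !skE => /eqP nz.
by rewrite mulVf.
Qed.

Lemma uinv0 : uinv 0 = 0.
Proof. by rewrite upiE; apply/uquotP/nearW => i; rewrite !skE invr0. Qed.

HB.instance Definition _ := GRing.ComNzRing_isField.Build uquot umulV uinv0.

Lemma uval0 : \forall i \near U, uval 0 i = 0.
Proof.
by apply: filterS (uval_pi sk_zero) => i ->; rewrite skE.
Qed.
Lemma uval1 : \forall i \near U, uval 1 i = 1.
Proof.
by apply: filterS (uval_pi sk_one) => i ->; rewrite skE.
Qed.
Lemma uvalN x : \forall i \near U, uval (- x) i = - uval x i.
Proof.
by apply: filterS (uval_pi (sk_opp (repr x))) => i ->; rewrite skE.
Qed.
Lemma uvalV x : \forall i \near U, uval (x^-1) i = (uval x i)^-1.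
Proof.
by apply: filterS (uval_pi (sk_inv (repr x))) => i ->; rewrite skE.
Qed.
Lemma uvalD x y : \forall i \near U, uval (x + y) i = uval x i + uval y i.
Proof.
by apply: filterS (uval_pi (sk_add (repr x) (repr y))) => i ->; rewrite skE.
Qed.
Lemma uvalM x y : \forall i \near U, uval (x * y) i = uval x i * uval y i.
Proof.
by apply: filterS (uval_pi (sk_mul (repr x) (repr y))) => i ->; rewrite skE.
Qed.

Definition unorm (x : uquot) : uquot := if ule 0 x then x else - x.

Lemma ule0 x : ule 0 x <-> \forall i \near U, 0 <= uval x i.
Proof.
split=> [/asboolP le0x|le0x].
  by apply: filterS2 uval0 le0x => i ->.
by apply/asboolP; apply: filterS2 uval0 le0x => i ->.
Qed.

Lemma ule0_add x y : ule 0 x -> ule 0 y -> ule 0 (x + y).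
Proof.
move=> /ule0 x0 /ule0 y0; apply/ule0.
by apply: filterS3 (uvalD x y) x0 y0 => i -> *; rewrite addr_ge0.
Qed.

Lemma ule0_mul x y : ule 0 x -> ule 0 y -> ule 0 (x * y).
Proof.
move=> /ule0 x0 /ule0 y0; apply/ule0.
by apply: filterS3 (uvalM x y) x0 y0 => i -> *; rewrite mulr_ge0.
Qed.

Lemma ule_anti x y : ule x y -> ule y x -> x = y.
Proof.
move=> /asboolP xy /asboolP yx; apply/uvalP.
by apply: filterS2 xy yx => i xy yx; apply: le_anti; rewrite xy yx.
Qed.

Lemma usub_ge0 x y : ule 0 (y - x) = ule x y.
Proof.
have vB : \forall i \near U, uval (y - x) i = uval y i - uval x i.
  by apply: filterS2 (uvalD y (- x)) (uvalN x) => i -> ->.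
apply/idP/idP => [/ule0 yx|/asboolP xy].
  by apply/asboolP; apply: filterS2 vB yx => i ->; rewrite subr_ge0.
by apply/ule0; apply: filterS2 vB xy => i ->; rewrite subr_ge0.
Qed.

Lemma ule_total x y : ule x y || ule y x.
Proof.
have [] := @near_or _ U (fun i => uval x i <= uval y i)
  (fun i => uval y i <= uval x i).
- by apply: nearW => i; apply/orP; exact: le_total.
- by move=> xy; apply/orP; left; apply/asboolP.
- by move=> xy; apply/orP; right; apply/asboolP.
Qed.

Lemma unorm_ge0 x : ule 0 x -> unorm x = x.
Proof. by rewrite /unorm => ->. Qed.

Lemma unormN x : unorm (- x) = unorm x.
Proof.
rewrite /unorm -{1}[- x]add0r usub_ge0 opprK.
case: ifPn => [x0|nx0]; case: ifPn => [x0'|nx0'] //.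
- by rewrite (ule_anti x0 x0') oppr0.
- by have := ule_total 0 x; rewrite (negbTE nx0) (negbTE nx0').
Qed.

HB.instance Definition _ := Num.IntegralDomain_isLeReal.Build uquot
  ule0_add ule0_mul (fun x le0x lex0 => esym (ule_anti le0x lex0)) usub_ge0
  (ule_total 0) unormN unorm_ge0 (fun x y => erefl).

Definition ultrafield : realFieldType := uquot.

Lemma uval_le (x y : ultrafield) :
  x <= y <-> \forall i \near U, uval x i <= uval y i.
Proof. by split=> /asboolP. Qed.

Lemma uval_term n (t : of_term n) (e : 'I_n -> ultrafield) :
  \forall i \near U,
    uval (eval_term e t) i = eval_term (fun j => uval (e j) i) t.
Proof.
elim: t => [j|||t IHt u IHu|t IHt|t IHt u IHu] /=.
- exact: nearW.
- exact: uval0.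
- exact: uval1.
- apply: filterS3 (uvalD (eval_term e t) (eval_term e u)) IHt IHu.
  by move=> i -> -> ->.
- by apply: filterS2 (uvalN (eval_term e t)) IHt => i -> ->.
- apply: filterS3 (uvalM (eval_term e t) (eval_term e u)) IHt IHu.
  by move=> i -> -> ->.
Qed.

Lemma sk_exists n (f : of_formula n.+1) (e : 'I_n -> ultrafield) :
  exists x : ultrafield, \forall i \near U,
      (exists y, holds (env_cons y (fun j => uval (e j) i)) f) ->
      holds (fun j => uval (env_cons x e j) i) f.
Proof.
have [s sP] := sk_closed f (fun j => repr (e j)).
exists (pi s); apply: filterS (uval_pi s) => i vs.
by move=> /sP; rewrite (env_cons_comp (fun x => uval x i)) vs.
Qed.

(** Theorem of Los.  The ultrafilter property handles the connectives, and
    [sk_exists] the quantifiers: it turns witnesses at single indices into one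
    element of the quotient.  For a universal formula it is applied to the
    counterexamples. *)
Theorem los n (f : of_formula n) (e : 'I_n -> ultrafield) :
  holds e f <-> \forall i \near U, holds (fun j => uval (e j) i) f.
Proof.
elim: f e => {n} [n t u|n t u|n|n f IHf g IHg|n f IHf g IHg|n f IHf g IHg
                 |n f IHf|n f IHf] e /=.
- rewrite uvalP; split=> [tu|tu].
    by apply: filterS3 (uval_term t e) (uval_term u e) tu => i <- <-.
  by apply: filterS3 (uval_term t e) (uval_term u e) tu => i -> ->.
- rewrite uval_le; split=> [tu|tu].
    by apply: filterS3 (uval_term t e) (uval_term u e) tu => i <- <-.
  by apply: filterS3 (uval_term t e) (uval_term u e) tu => i -> ->.
- by split=> // UF; suff : U set0 by exact: filter_not_empty.
- rewrite IHf IHg; split=> [[]|fg]; first by apply: filterS2.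
  by split; apply: filterS fg => i [].
- rewrite IHf IHg; split=> [[]|]; last exact: near_or.
    by apply: filterS => i; left.
  by apply: filterS => i; right.
- rewrite IHf IHg; split=> [fg|fg Uf].
    have [Uf|/near_not nf] :=
      pselect (\forall i \near U, holds (fun j => uval (e j) i) f).
      by apply: filterS (fg Uf).
    by apply: filterS nf.
  by apply: filterS2 fg Uf => i; apply.
- split=> [fe|fe x]; last first.
    apply/IHf; apply: filterS fe => i /(_ (uval x i)).
    by rewrite (env_cons_comp (fun x => uval x i)).
  apply: contrapT => /near_not nf.
  have [x xP] := sk_exists (FImp f (FFalse _)) e.
  have /IHf fx := fe x.
  suff : U set0 by exact: filter_not_empty.
  apply: filterS3 nf xP fx => i /existsNP[y nfy] /= xP fx.
  by apply: xP => //; exists y.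
- split=> [[x /IHf fx]|fe].
    apply: filterS fx => i fx; exists (uval x i).
    by move: fx; rewrite (env_cons_comp (fun x => uval x i)).
  have [x xP] := sk_exists f e; exists x; apply/IHf.
  by apply: filterS2 fe xP => i fi; apply.
Qed.

Lemma ultrafield_equivalent : elementarily_equivalent ultrafield L.
Proof.
move=> f; rewrite /sentence_true los.
have E i : holds (fun j : 'I_0 =>
    uval (match notF (ltn_ord j) return ultrafield with end) i) f =
  holds (fun j : 'I_0 => match notF (ltn_ord j) return L with end) f.
  by congr holds; apply/funext => -[].
split=> [/filter_ex[i]|fL]; first by rewrite E.
by apply: nearW => i; rewrite E.
Qed.

End UltraQuotient.

(** * Standard numbers, nonstandardness and finite parts *)

Section Values.
Variables (I : Type) (F : skolem_family I rat).
Local Notation K := (ultrafield F).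
Local Notation U := (sk_filter F).

Lemma uval_nat (n : nat) : \forall i \near U, uval (n%:R : K) i = n%:R.
Proof.
elim: n => [|n IHn]; first exact: uval0.
rewrite -natr1; apply: filterS3 (uvalD (n%:R : K) 1) IHn (uval1 F).
by move=> i -> -> ->; rewrite natr1.
Qed.

Lemma uval_int (z : int) : \forall i \near U, uval (z%:~R : K) i = z%:~R.
Proof.
case: z => n; first exact: uval_nat.
rewrite NegzE !mulrNz; apply: filterS2 (uvalN (n.+1%:R : K)) (uval_nat n.+1).
by move=> i -> ->.
Qed.

Lemma uval_ratr (q : rat) : \forall i \near U, uval (ratr q : K) i = q.
Proof.
rewrite /ratr; set a := (numq q)%:~R; set b := (denq q)%:~R.
have vb : \forall i \near U, uval b^-1 i = (denq q)%:~R^-1.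
  by apply: filterS2 (uvalV b) (uval_int (denq q)) => i -> ->.
apply: filterS3 (uvalM a b^-1) (uval_int (numq q)) vb => i -> -> ->.
exact: divq_num_den.
Qed.

(** The two hypotheses say, in terms of rational bounds only, that the values
    of [x] have limit [m] along the ultrafilter. *)
Lemma fp_ultrafield (R : realType) (x : K) (m : R) :
  (forall q : rat, ratr q < m -> \forall i \near U, q <= uval x i) ->
  (forall q : rat, m < ratr q -> \forall i \near U, uval x i < q) ->
  fin_part K x /\ fp R K x = m.
Proof.
move=> xlo xhi.
have lo q : ratr q < m -> ratr q <= x.
  move=> /xlo qx; apply/uval_le.
  by apply: filterS2 (uval_ratr q) qx => i ->.
have hi q : m < ratr q -> x < ratr q.
  move=> /xhi qx; rewrite ltNge; apply/negP => /uval_le xq.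
  suff : U set0 by exact: filter_not_empty.
  apply: filterS3 (uval_ratr q) qx xq => i -> xq qx.
  by have := lt_le_trans xq qx; rewrite ltxx.
have [n nP] : exists n : nat, `|m| < n%:R.
  by exists (Num.bound `|m|); exact: archi_boundP.
have {nP} /andP[nm mn] : - n%:R < m < n%:R by rewrite -ltr_norml.
split.
  exists n%:R; rewrite -raddfN/= lo ?rmorphN ?rmorph_nat//=.
  by apply/ltW; have := @hi n%:R; rewrite !rmorph_nat; apply.
have ubm : ubound [set ratr q | q in [set q : rat | ratr q <= x]] m.
  move=> _ [q /= qx <-]; rewrite leNgt; apply/negP => /hi.
  by rewrite ltNge qx.
have mem q : ratr q < m ->
    [set ratr q | q in [set q : rat | ratr q <= x]] (ratr q : R).
  by move=> /lo qx; exists q.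
apply/eqP; rewrite eq_le; apply/andP; split.
  apply: ge_sup ubm; exists (ratr (- n%:R)); apply: mem.
  by rewrite rmorphN rmorph_nat.
rewrite leNgt; apply/negP => /rat_in_itvoo[q]; rewrite in_itv/= => /andP[sq qm].
have : ratr q <= fp R K x by apply: ub_le_sup; [exists m|exact: mem].
by rewrite leNgt sq.
Qed.

End Values.

(** An isomorphism with the rationals would make the field archimedean, but the
    class of [w] eventually exceeds every natural number. *)
Lemma ultrafield_nonstandard (F : skolem_family nat rat) (w : sk_index F) :
  \oo `<=` sk_filter F -> (forall i, sk_val w i = i%:R) ->
  nonstandard_model (ultrafield F).
Proof.
move=> ooF wE; split; first exact: ultrafield_equivalent.
move=> [f [_ fmono]].
pose x : ultrafield F := \pi_(uquot F) w.
have [n fxn] : exists n : nat, f x < n%:R.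
  exists (Num.bound `|f x|).
  by apply: le_lt_trans (ler_norm _) (archi_boundP _).
have /uval_le xn : x <= n%:R by rewrite -fmono rmorph_nat ltW.
suff : sk_filter F set0 by exact: filter_not_empty.
have Fn : \forall i \near sk_filter F, (n < i)%N by apply: ooF; exists n.+1.
apply: filterS2 (filterI (uval_pi w) (uval_nat F n)) (filterI xn Fn) => i.
by move=> [vx vn] [+ ni]; rewrite [uval x i]vx vn wE ler_nat leqNgt ni.
Qed.

(** * The Skolem hull of a set of sequences *)

(** Trees labelled by natural numbers form a countable type; formulas inherit an
    injective code from it. *)
Fixpoint term_tree (n : nat) (t : of_term n) : GenTree.tree nat :=
  match t with
  | TVar i => GenTree.Leaf (nat_of_ord i)
  | TZero => GenTree.Node 0 [::]
  | TOne => GenTree.Node 1 [::]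
  | TAdd t u => GenTree.Node 2 [:: term_tree t; term_tree u]
  | TOpp t => GenTree.Node 3 [:: term_tree t]
  | TMul t u => GenTree.Node 4 [:: term_tree t; term_tree u]
  end.

Fixpoint formula_tree (n : nat) (f : of_formula n) : GenTree.tree nat :=
  match f with
  | FEq t u => GenTree.Node 0 [:: term_tree t; term_tree u]
  | FLe t u => GenTree.Node 1 [:: term_tree t; term_tree u]
  | FFalse => GenTree.Node 2 [::]
  | FAnd f g => GenTree.Node 3 [:: formula_tree f; formula_tree g]
  | FOr f g => GenTree.Node 4 [:: formula_tree f; formula_tree g]
  | FImp f g => GenTree.Node 5 [:: formula_tree f; formula_tree g]
  | FForall f => GenTree.Node 6 [:: formula_tree f]
  | FExists f => GenTree.Node 7 [:: formula_tree f]
  end.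

Lemma term_tree_inj n : injective (@term_tree n).
Proof.
elim=> [i|||t IHt u IHu|t IHt|t IHt u IHu] [j|||t' u'|t'|t' u'] //=.
- by move=> [/val_inj ->].
- by move=> [/IHt -> /IHu ->].
- by move=> [/IHt ->].
- by move=> [/IHt -> /IHu ->].
Qed.

Lemma formula_tree_inj n : injective (@formula_tree n).
Proof.
elim=> {n} [n t u|n t u|n|n f IHf g IHg|n f IHf g IHg|n f IHf g IHg
           |n f IHf|n f IHf] [t' u'|t' u'||f' g'|f' g'|f' g'|f'|f'] //=.
- by move=> [/term_tree_inj -> /term_tree_inj ->].
- by move=> [/term_tree_inj -> /term_tree_inj ->].
- by move=> [/IHf -> /IHg ->].
- by move=> [/IHf -> /IHg ->].
- by move=> [/IHf -> /IHg ->].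
- by move=> [/IHf ->].
- by move=> [/IHf ->].
Qed.

(** The number [n] of free variables is part of the code, since formulas with
    different numbers of variables may have the same tree. *)
Definition formula_code (n : nat) (f : of_formula n) : nat :=
  pickle (n, formula_tree f).

Section SkolemHull.
Variables (I : Type) (L : realFieldType) (T : choiceType) (g : T -> I -> L).

(** The formula to be satisfied is referred to by its code, which makes the
    operation one of a countable list; the arguments are padded by zeros. *)
Definition skolem_fun (k : nat) (s : seq L) : L :=
  xget 0 [set x | exists n (f : of_formula n.+1),
    formula_code f = k /\ holds (env_cons x (fun j : 'I_n => s`_j)) f].

Lemma skolem_funP n (f : of_formula n.+1) (s : seq L) :
  (exists x, holds (env_cons x (fun j : 'I_n => s`_j)) f) ->
  holds (env_cons (skolem_fun (formula_code f) s) (fun j : 'I_n => s`_j)) f.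
Proof.
move=> [x fx]; rewrite /skolem_fun; case: xgetP => [y -> [m [h [+ hy]]]|/(_ x)].
  move=> /(pcan_inj pickleK)[mn]; subst m => /formula_tree_inj hf.
  by rewrite hf in hy.
by case; exists n, f.
Qed.

(** Inner nodes are labelled by codes of formulas, whose Skolem functions are
    applied at each index separately. *)
Fixpoint hull_val (t : GenTree.tree T) (i : I) : L :=
  match t with
  | GenTree.Leaf x => g x i
  | GenTree.Node k ts => skolem_fun k [seq hull_val u i | u <- ts]
  end.

Lemma hull_closed n (f : of_formula n.+1) (e : 'I_n -> GenTree.tree T) :
  exists t, forall i,
    (exists x, holds (env_cons x (fun j => hull_val (e j) i)) f) ->
    holds (env_cons (hull_val t i) (fun j => hull_val (e j) i)) f.
Proof.
exists (GenTree.Node (formula_code f) [seq e j | j <- enum 'I_n]) => i /=.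
rewrite -map_comp; set s := map _ _.
have -> : (fun j => hull_val (e j) i) = (fun j : 'I_n => s`_j).
  by apply/funext => j; rewrite (nth_map j) ?size_enum_ord// nth_ord_enum.
exact: skolem_funP.
Qed.

Definition hull (U : set_system I) (UU : UltraFilter U) : skolem_family I L :=
  SkolemFamily UU hull_closed.

End SkolemHull.

(** * The model attached to a set of reals *)

(** Approximation from below makes the upper bound in [fp_ultrafield]
    immediate. *)
Lemma rat_approx (R : realType) (m : R) :
  exists a : nat -> rat, forall i, m - i.+1%:R^-1 < ratr (a i) < m.
Proof.
have /choice[a aP] (i : nat) : exists q : rat, m - i.+1%:R^-1 < ratr q < m.
  have [|q] := @rat_in_itvoo R (m - i.+1%:R^-1) m.
    by rewrite gtrBl invr_gt0.
  by rewrite in_itv /=; exists q.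
by exists a.
Qed.

(** The surjection from trees bounds the cardinality of the model. *)
Lemma exists_model (R : realType) (M : set R) :
  exists K : realFieldType,
    [/\ nonstandard_model K, M `<=` fp R K @` fin_part K
      & exists p : GenTree.tree (option M) -> K, range p = setT].
Proof.
have [U [UU ooU]] := ultraFilterLemma eventually_filter.
have /choice[a aP] := @rat_approx R.
(* The generator [None] is the sequence that becomes infinitely large. *)
pose g (o : option M) (i : nat) : rat :=
  if o is Some m then a (val m) i else i%:R.
pose F := hull g UU.
exists (ultrafield F); split.
- exact: (@ultrafield_nonstandard F (GenTree.Leaf None)).
- move=> m Mm; pose t : sk_index F := GenTree.Leaf (Some (SigSub (mem_set Mm))).
  have [||xfin fpx] := @fp_ultrafield _ F R (\pi_(uquot F) t) m.
  + move=> q /ltr_add_invr[k qk].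
    have : \forall i \near U, (k <= i)%N by apply: ooU; exists k.
    apply: filterS2 (uval_pi t) => i -> ki /=.
    rewrite -(ler_rat R); apply: ltW.
    have /andP[+ _] := aP m i; apply: le_lt_trans.
    rewrite lerBrDr; apply: le_trans (ltW qk); rewrite lerD2l.
    by rewrite lef_pV2 ?posrE// ler_nat.
  + move=> q mq; apply: filterS (uval_pi t) => i -> /=.
    by rewrite -(ltr_rat R); have /andP[_ am] := aP m i; apply: lt_trans am mq.
  + by exists (\pi_(uquot F) t).
- exists (fun t => \pi_(uquot F) t : ultrafield F).
  by apply/seteqP; split=> // x _; exists (repr x) => //; rewrite reprK.
Qed.

Theorem proposition1p2 (R : realType) (M : set R) :
  (exists K : realFieldType,
     nonstandard_model K /\ M `<=` fp R K @` fin_part K) /\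
  (infinite_set M ->
   exists K : realFieldType,
     [/\ nonstandard_model K, M `<=` fp R K @` fin_part K
       & [set: K] #= M]).
Proof.
have [K [Kns MK [p pK]]] := exists_model M; split; first by exists K.
move=> Minf; exists K; split=> //.
have /andP[TM MT] : ([set: M] #<= M) && (M #<= [set: M]).
  by rewrite -card_eq_le card_setT.
have TMinf : infinite_set [set: M].
  by apply/infiniteP/(card_le_trans _ MT)/infiniteP.
have oinf : infinite_set [set: option M].
  move=> fin; apply: TMinf; apply: card_le_finite fin.
  by apply: (inj_card_leT (f := @Some M)) => x y [].
rewrite card_eq_le; apply/andP; split.
  rewrite -pK; apply: card_le_trans (card_image_le _ _) _.
  apply: card_le_trans (inj_card_leT (pcan_inj (GenTree.codeK (option M)))) _.
  apply: card_le_trans (card_seq_infinite oinf) _.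
  exact: card_le_trans (card_option_infinite TMinf) TM.
apply: card_le_trans (subset_card_le MK) _.
apply: card_le_trans (card_image_le _ _) _; exact: card_leT.
Qed.
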